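(* Let $a,\alpha_i,b,\beta_i$ be admissible parameters of an affine process on $\mathbb R^m_+\times\mathbb R^n$, with diffusion matrix $\alpha(x)=a+\sum_{i\in I}x_i\alpha_i$ and $\mathcal B=(\beta_1,\dots,\beta_d)$. There exists some invertible $d\times d$-matrix $\Lambda$ with $\Lambda(\mathbb R^m_+\times\mathbb R^n)=\mathbb R^m_+\times\mathbb R^n$ such that $\Lambda\alpha(\Lambda^{-1}y)\Lambda^\top$ is block-diagonal of the form $$\Lambda\alpha(\Lambda^{-1}y)\Lambda^\top=\begin{pmatrix}\mathrm{diag}(y_1,\dots,y_q,0,\dots,0)&0\\0&p+\sum_{i\in I}y_i\pi_i\end{pmatrix}$$ for some integer $0\le q\le m$ and symmetric positive semi-definite $n\times n$ matrices $p,\pi_1,\dots,\pi_m$. Moreover, $\Lambda b$ and $\Lambda\mathcal B\Lambda^{-1}$ meet the respective admissibility conditions in lieu of $b$ and $\mathcal B$; that is, $\Lambda b\in\mathbb R^m_+\times\mathbb R^n$, $(\Lambda\mathcal B\Lambda^{-1})_{IJ}=0$, and $(\Lambda\mathcal B\Lambda^{-1})_{II}$ has nonnegative off-diagonal elements.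
   Context: Let $m,n\ge0$ be integers with $m+n=d\ge1$; $I=\{1,\dots,m\}$, $J=\{m+1,\dots,d\}$; $\nu_{MN}=(\nu_{ij})_{i\in M,j\in N}$ for index sets $M,N$. $\mathrm{diag}(z_1,\dots,z_m)$ is the diagonal $m\times m$ matrix with diagonal elements $z_1,\dots,z_m$. The real $d\times d$-matrices $a,\alpha_1,\dots,\alpha_d$ and vectors $b,\beta_1,\dots,\beta_d\in\mathbb R^d$ are admissible if: $a,\alpha_i$ are symmetric positive semi-definite; $a_{II}=0$ (thus $a_{IJ}=a_{JI}^\top=0$); $\alpha_j=0$ for $j\in J$; $\alpha_{i,kl}=\alpha_{i,lk}=0$ for $k\in I\setminus\{i\}$ and all $1\le i,l\le d$ (where $\alpha_{i,kl}$ is the $(k,l)$ entry of $\alpha_i$); $b\in\mathbb R^m_+\times\mathbb R^n$; $\mathcal B_{IJ}=0$; $\mathcal B_{II}$ has nonnegative off-diagonal elements, where $\mathcal B$ is the matrix with $i$-th column $\beta_i$. These are exactly the parameters of affine diffusion processes on $\mathbb R^m_+\times\mathbb R^n$ with drift $b+\mathcal Bx$ and diffusion matrix $a+\sum_{i}x_i\alpha_i$. *)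

(* Defs.v *)
From HB Require Import structures.
From mathcomp Require Import all_boot all_order all_algebra.
From mathcomp Require Import classical_sets reals.

Set Implicit Arguments.
Unset Strict Implicit.
Unset Printing Implicit Defensive.

Import Order.TTheory GRing.Theory Num.Theory.
Local Open Scope ring_scope.
Local Open Scope classical_set_scope.

(* A vector of R^d, d = m + n, is a column 'cV[R]_(m + n).  The index set I is
   the range of [lshift n : 'I_m -> 'I_(m + n)] and J that of
   [rshift m : 'I_n -> 'I_(m + n)]; hence M_II = ulsubmx M, M_IJ = ursubmx M,
   M_JI = dlsubmx M and M_JJ = drsubmx M. *)

Definition state_space (R : realType) (m n : nat) : set 'cV[R]_(m + n) :=
  [set x | forall i : 'I_m, 0 <= x (lshift n i) 0].
Arguments state_space : clear implicits.

Definition sym_psd (R : realType) (d : nat) (A : 'M[R]_d) : Prop :=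
  A^T = A /\ forall v : 'cV[R]_d, 0 <= (v^T *m A *m v) 0 0.

Definition drift_matrix (R : realType) (d : nat) (beta : 'I_d -> 'cV[R]_d) :
    'M[R]_d :=
  \matrix_(k < d, i < d) beta i k 0.

Definition diffusion (R : realType) (m n : nat) (a : 'M[R]_(m + n))
    (alpha : 'I_(m + n) -> 'M[R]_(m + n)) (x : 'cV[R]_(m + n)) :
    'M[R]_(m + n) :=
  a + \sum_(i < m) x (lshift n i) 0 *: alpha (lshift n i).

Record admissible_diffusion (R : realType) (m n : nat) (a : 'M[R]_(m + n))
    (alpha : 'I_(m + n) -> 'M[R]_(m + n)) : Prop := AdmissibleDiffusion {
  adm_a_psd : sym_psd a;
  adm_alpha_psd : forall i, sym_psd (alpha i);
  adm_a_II : ulsubmx a = 0;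
  adm_alpha_J : forall j : 'I_n, alpha (rshift m j) = 0;
  adm_alpha_I : forall (i l : 'I_(m + n)) (k : 'I_m), lshift n k != i ->
    alpha i (lshift n k) l = 0 /\ alpha i l (lshift n k) = 0
}.

Record admissible_drift (R : realType) (m n : nat) (b : 'cV[R]_(m + n))
    (B : 'M[R]_(m + n)) : Prop := AdmissibleDrift {
  adm_b : state_space R m n b;
  adm_B_IJ : ursubmx B = 0;
  adm_B_II : forall i j : 'I_m, i != j -> 0 <= ulsubmx B i j
}.

Definition admissible (R : realType) (m n : nat) (a : 'M[R]_(m + n))
    (alpha : 'I_(m + n) -> 'M[R]_(m + n)) (b : 'cV[R]_(m + n))
    (beta : 'I_(m + n) -> 'cV[R]_(m + n)) : Prop :=
  admissible_diffusion a alpha /\ admissible_drift b (drift_matrix beta).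

(* Main.v *)
Require Import Defs.
From HB Require Import structures.
From mathcomp Require Import all_boot all_order all_algebra.
From mathcomp Require Import fingroup perm.
From mathcomp Require Import classical_sets reals.

(** Admissibility leaves very little room in the first [m] coordinates: a
    positive semi-definite matrix with a zero diagonal entry has a zero row
    there ([sym_psd_diag0]), so [a] lives in the [JJ] block, and [alpha_i] has,
    outside its [JJ] block, only the entry [c_i = alpha_(i,ii) >= 0], the row
    [u_i = alpha_(i,iJ)] and its transpose, with [u_i = 0] as soon as [c_i =
    0]. The change of variables is therefore sought in the block form [(S, 0;
    D, 1)]. The choice [D_i = - u_i^T / c_i] (and [D_i = 0] when [c_i = 0]) is
    one step of Gaussian elimination, done for all [i] at once because the
    column [D_i] only sees [alpha_i]: it removes the off-diagonal blocks. The
    matrix [S] multiplies the coordinate [x_i] by [s_i = 1 / c_i] (by [1] when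
    [c_i = 0]), so that the diagonal entry [s_i ^ 2 * c_i * x_i] is [s_i * x_i]
    when [c_i > 0] and [0] otherwise, and permutes the coordinates so that
    those with [c_i > 0] come first; [q] is their number.

    No Schur complement has to be computed to see that [p] and the [pi_i] are
    positive semi-definite: they are diagonal blocks of congruent transforms of
    [a] and [alpha_i] ([sym_psd_congr], [sym_psd_drsub]).

    As [S] is a positively scaled permutation, conjugating by it preserves the
    sign of off-diagonal entries, and the zero upper right block of the change
    of variables makes both the orthant condition and [B_IJ = 0] stable, [D]
    having no effect on the [I] coordinates. *)

Set Implicit Arguments.
Unset Strict Implicit.
Unset Printing Implicit Defensive.

Import Order.TTheory GRing.Theory Num.Theory.
Local Open Scope ring_scope.
Local Open Scope classical_set_scope.

(** * Positive semi-definite matrices *)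

Section PositiveSemiDefinite.
Variable R : realType.

Lemma quad_form_delta d (A : 'M[R]_d) (k l : 'I_d) :
  ((delta_mx k 0 : 'cV[R]_d)^T *m A *m (delta_mx l 0 : 'cV[R]_d)) 0 0 = A k l.
Proof. by rewrite trmx_delta -rowE -colE !mxE. Qed.

Lemma sym_psd_diag_ge0 d (A : 'M[R]_d) k : sym_psd A -> 0 <= A k k.
Proof. by case=> _ /(_ (delta_mx k 0)); rewrite quad_form_delta. Qed.

(** On [t e_k + e_l] the quadratic form is [2 t A_kl + A_ll] when [A_kk = 0];
    an affine function of [t] bounded below has zero slope. *)
Lemma sym_psd_diag0 d (A : 'M[R]_d) k l :
  sym_psd A -> A k k = 0 -> A k l = 0.
Proof.
move=> [Asym Apos] Akk0; apply/eqP; apply: contraT => Akl_neq0.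
have Alk : A l k = A k l by rewrite -{1}Asym mxE.
(* this value of t makes the quadratic form equal to -1 *)
pose t := - (A l l + 1) / (2 * A k l).
have := Apos (t *: delta_mx k 0 + delta_mx l 0).
rewrite [(_ + _)^T]linearD /= [(_ *: _)^T]linearZ /=.
rewrite !mulmxDl !mulmxDr -!scalemxAl -!scalemxAr.
have addE (X Y : 'M[R]_1) : (X + Y) 0 0 = X 0 0 + Y 0 0 by rewrite mxE.
have scaleE r (X : 'M[R]_1) : (r *: X) 0 0 = r * X 0 0 by rewrite mxE.
rewrite !addE !scaleE !quad_form_delta Akk0 Alk !mulr0 add0r.
have -> : t * A k l + (t * A k l + A l l) = -1.
  rewrite addrA -mulr2n -mulr_natl /t.
  rewrite [2 * _]mulrCA divfK ?mulf_neq0 ?pnatr_eq0//.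
  by rewrite opprD addrAC addNr add0r.
by rewrite ler0N1.
Qed.

Lemma sym_psd_congr d (A L : 'M[R]_d) : sym_psd A -> sym_psd (L *m A *m L^T).
Proof.
move=> [Asym Apos]; split; first by rewrite !trmx_mul trmxK Asym mulmxA.
by move=> v; have := Apos (L^T *m v); rewrite trmx_mul trmxK !mulmxA.
Qed.

Lemma sym_psdZ d (A : 'M[R]_d) t : 0 <= t -> sym_psd A -> sym_psd (t *: A).
Proof.
move=> t_ge0 [Asym Apos]; split=> [|v]; first by rewrite linearZ /= Asym.
by rewrite -scalemxAr -scalemxAl mxE mulr_ge0.
Qed.

Lemma sym_psd_drsub m n (A : 'M[R]_(m + n)) :
  sym_psd A -> sym_psd (drsubmx A).
Proof.
move=> [Asym Apos]; split; first by rewrite trmx_drsub Asym.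
move=> v; have := Apos (col_mx 0 v).
rewrite -{1}[A]submxK tr_col_mx trmx0 mul_row_block mul_row_col.
by rewrite !mul0mx !add0r mulmx0 add0r.
Qed.

Lemma sym_block_diag m n (A : 'M[R]_(m + n)) :
  A^T = A -> ursubmx A = 0 -> A = block_mx (ulsubmx A) 0 0 (drsubmx A).
Proof.
move=> Asym ur0; rewrite -{1}[A]submxK ur0.
by rewrite -[A in dlsubmx A]Asym -trmx_ursub ur0 trmx0.
Qed.

End PositiveSemiDefinite.

(** * Scaled permutation matrices *)

Lemma exists_perm_prefix m (P : pred 'I_m) :
  exists t : 'S_m, forall k : 'I_m, P (t k) = (k < #|P|)%N.
Proof.
(* t lists the indices satisfying P, then the others *)
pose s := [seq x <- enum 'I_m | P x] ++ [seq x <- enum 'I_m | predC P x].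
have : perm_eq s (ord_tuple m) by rewrite perm_filterC val_ord_tuple.
case/tuple_permP=> t st; exists t => k.
have sizeP : size [seq x <- enum 'I_m | P x] = #|P|.
  by rewrite cardE enumT /enum_mem -enumT.
have -> : t k = nth (t k) s k.
  rewrite st -[X in _ = nth _ X _]/(tval _).
  by rewrite -(tnth_nth (t k) _ k) tnth_mktuple tnth_ord_tuple.
have ks : (k < size s)%N by rewrite st size_tuple.
move: ks; rewrite /s size_cat nth_cat sizeP => ks.
case: ltnP => [kP | Pk].
  have: nth (t k) [seq x <- enum 'I_m | P x] k \in [seq x <- enum 'I_m | P x].
    by rewrite mem_nth ?sizeP.
  by rewrite mem_filter => /andP[].
set u := nth _ _ _.
have: u \in [seq x <- enum 'I_m | predC P x].
  by rewrite mem_nth// ltn_subLR.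
by rewrite mem_filter /= => /andP[/negbTE].
Qed.

Section ScaledPermutation.
Variables (F : fieldType) (m : nat).
Implicit Types (s : 'I_m -> F) (t : 'S_m).

Definition scaled_perm s t : 'M[F]_m := \matrix_(i, j) (s j *+ (t i == j)).

Lemma mul_scaled_perm s t n (A : 'M[F]_(m, n)) i j :
  (scaled_perm s t *m A) i j = s (t i) * A (t i) j.
Proof.
rewrite mxE (bigD1 (t i))//= mxE eqxx big1 ?addr0// => k /negbTE kt.
by rewrite mxE eq_sym kt mul0r.
Qed.

Lemma mul_tr_scaled_perm s t n (A : 'M[F]_(n, m)) i j :
  (A *m (scaled_perm s t)^T) i j = s (t j) * A i (t j).
Proof. by rewrite -[A]trmxK -trmx_mul [LHS]mxE mul_scaled_perm !mxE. Qed.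

(** The transpose undoes the permutation, and reciprocal factors the
    scaling. *)
Lemma scaled_permV s t : (forall i, s i != 0) ->
  scaled_perm s t *m (scaled_perm (fun i => (s i)^-1) t)^T = 1%:M.
Proof.
move=> s_neq0; apply/matrixP => i j; rewrite mul_tr_scaled_perm !mxE.
rewrite (inj_eq perm_inj); case: eqP => _; last by rewrite mulr0.
by rewrite mulVf.
Qed.

End ScaledPermutation.

(** * Block triangular changes of variables *)

Section BlockTriangular.
Variables (F : fieldType) (m n : nat).
Implicit Types (S T : 'M[F]_m) (D : 'M[F]_(n, m)) (A : 'M[F]_(m + n)).

Lemma block_shearV S T D : S *m T = 1%:M ->
  block_mx S 0 D 1%:M *m block_mx T 0 (- (D *m T)) 1%:M = 1%:M.
Proof.
move=> ST1; rewrite mulmx_block ST1 !mul0mx !mul1mx !mulmx0 !addr0 !add0r.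
by rewrite addrN scalar_mx_block.
Qed.

Lemma usubmx_block_shear S D p (x : 'M[F]_(m + n, p)) :
  usubmx (block_mx S 0 D 1%:M *m x) = S *m usubmx x.
Proof.
by rewrite -{1}[x]vsubmxK mul_block_col mul0mx addr0 col_mxKu.
Qed.

Lemma block_shear_congr S D A : let L := block_mx S 0 D 1%:M in
  ulsubmx (L *m A *m L^T) = S *m ulsubmx A *m S^T /\
  ursubmx (L *m A *m L^T) = S *m (ulsubmx A *m D^T + ursubmx A).
Proof.
move=> L; have -> : L *m A *m L^T =
    L *m block_mx (ulsubmx A) (ursubmx A) (dlsubmx A) (drsubmx A) *m L^T.
  by rewrite submxK.
rewrite /L tr_block_mx trmx0 trmx1 !mulmx_block.
rewrite block_mxKul block_mxKur !mul0mx !mulmx0 !addr0 !mulmx1.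
by rewrite mulmxDr mulmxA.
Qed.

Lemma block_shear_conj S T D A : S *m T = 1%:M -> ursubmx A = 0 ->
  let L := block_mx S 0 D 1%:M in
  ulsubmx (L *m A *m invmx L) = S *m ulsubmx A *m T /\
  ursubmx (L *m A *m invmx L) = 0.
Proof.
move=> ST1 ur0 L; have LV := block_shearV D ST1.
have [Lu _] := mulmx1_unit LV.
have -> : invmx L = block_mx T 0 (- (D *m T)) 1%:M.
  by rewrite -[RHS](mulKmx Lu) LV mulmx1.
have -> : L *m A = L *m block_mx (ulsubmx A) 0 (dlsubmx A) (drsubmx A).
  by rewrite -{1}[A]submxK ur0.
rewrite /L !mulmx_block block_mxKul block_mxKur.
by rewrite !mul0mx !mulmx0 !addr0 !mul0mx !addr0.
Qed.

Lemma sum_block_diag k (f : 'I_k -> F) (U : 'I_k -> 'M[F]_m)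
    (V : 'I_k -> 'M[F]_n) :
  \sum_i f i *: block_mx (U i) 0 0 (V i) =
  block_mx (\sum_i f i *: U i) 0 0 (\sum_i f i *: V i).
Proof.
elim/big_rec3: _ => [|i A B C _ ->]; first by rewrite -block_mx0.
by rewrite scale_block_mx add_block_mx !scaler0 !addr0.
Qed.

End BlockTriangular.

(** * The canonical form *)

Section CanonicalForm.
Variables (R : realType) (m n : nat).
Variables (a : 'M[R]_(m + n)) (alpha : 'I_(m + n) -> 'M[R]_(m + n)).
Hypothesis adm : admissible_diffusion a alpha.

Let c (i : 'I_m) : R := alpha (lshift n i) (lshift n i) (lshift n i).

Let c_ge0 i : 0 <= c i.
Proof. exact: sym_psd_diag_ge0 (adm_alpha_psd adm _). Qed.

Let s (i : 'I_m) : R := if 0 < c i then (c i)^-1 else 1.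

Let s_gt0 i : 0 < s i.
Proof. by rewrite /s; case: ifP => // c_gt0; rewrite invr_gt0. Qed.

Let mul_sc i : s i * c i = (0 < c i)%R%:R.
Proof.
rewrite /s; case: ltP => [c_gt0|c_le0]; first by rewrite mulVf ?gt_eqF.
by rewrite mul1r; apply: le_anti; rewrite c_le0 c_ge0.
Qed.

(* when c_i = 0 this column is 0 as required, because u_i = 0 *)
Let D : 'M[R]_(n, m) :=
  \matrix_(j, i) - (alpha (lshift n i) (lshift n i) (rshift m j) * s i).

Variable t : 'S_m.

Definition canonical_mx : 'M[R]_(m + n) :=
  block_mx (scaled_perm s t) 0 D 1%:M.

Let L := canonical_mx.

(** The state space and the drift conditions are preserved by every change of
    variables of this shape, whatever the positive factors and the lower left
    block. *)
Lemma canonical_mx_shape : exists2 f : 'I_m -> R, (forall i, 0 < f i) &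
  exists E, L = block_mx (scaled_perm f t) 0 E 1%:M.
Proof. by exists s => //; exists D. Qed.

Lemma alpha_ul i : ulsubmx (alpha (lshift n i)) = c i *: delta_mx i i.
Proof.
apply/matrixP => k l; rewrite !mxE.
have alpha0 := adm_alpha_I adm.
case: (eqVneq k i) => [->|ki] /=.
  case: (eqVneq l i) => [->|li] /=; first by rewrite mulr1.
  rewrite mulr0; apply: (alpha0 _ _ l _).2.
  by rewrite (inj_eq (@lshift_inj _ _)).
rewrite mulr0; apply: (alpha0 _ _ k _).1.
by rewrite (inj_eq (@lshift_inj _ _)).
Qed.

(** The elimination step: in row [i] this is [- c_i s_i u_i + u_i], which
    vanishes because [c_i s_i = 1] or [u_i = 0]. *)
Lemma alpha_elim i :
  ulsubmx (alpha (lshift n i)) *m D^T + ursubmx (alpha (lshift n i)) = 0.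
Proof.
apply/matrixP => k j; rewrite alpha_ul -scalemxAl !mxE.
case: (eqVneq k i) => [->|ki]; last first.
  rewrite big1 => [|l _]; last by rewrite !mxE (negbTE ki) mul0r.
  rewrite mulr0 add0r; apply: (adm_alpha_I adm _ _).1.
  by rewrite (inj_eq (@lshift_inj _ _)).
rewrite (bigD1 i)//= big1 => [|l li]; last first.
  by rewrite !mxE (negbTE li) andbF mul0r.
rewrite !mxE !eqxx mul1r addr0 mulrN mulrCA [c i * _]mulrC mul_sc.
case: ltP => [_|c_le0]; first by rewrite mulr1 addNr.
rewrite mulr0 oppr0 add0r.
apply: sym_psd_diag0 (adm_alpha_psd adm _) _.
by apply: le_anti; rewrite c_le0 c_ge0.
Qed.

Let p := drsubmx (L *m a *m L^T).

Let pi k := (s (t k))^-1 *: drsubmx (L *m alpha (lshift n (t k)) *m L^T).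

Lemma canonical_a : L *m a *m L^T = block_mx 0 0 0 p.
Proof.
have [ulE urE] := block_shear_congr (scaled_perm s t) D a.
have ur0 : ursubmx a = 0.
  apply/matrixP => i j; rewrite !mxE.
  apply: sym_psd_diag0 (adm_a_psd adm) _.
  by have /matrixP/(_ i i) := adm_a_II adm; rewrite !mxE.
have La_psd := sym_psd_congr L (adm_a_psd adm).
rewrite [LHS](sym_block_diag La_psd.1); last first.
  by rewrite urE (adm_a_II adm) ur0 mul0mx addr0 mulmx0.
by rewrite ulE (adm_a_II adm) mulmx0 mul0mx.
Qed.

Lemma canonical_alpha k :
  L *m alpha (lshift n (t k)) *m L^T =
  s (t k) *: block_mx ((0 < c (t k))%R%:R *: delta_mx k k) 0 0 (pi k).
Proof.
set A := alpha _.
have [ulE urE] := block_shear_congr (scaled_perm s t) D A.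
have LA_psd := sym_psd_congr L (adm_alpha_psd adm (lshift n (t k))).
rewrite [LHS](sym_block_diag LA_psd.1); last by rewrite urE alpha_elim mulmx0.
rewrite scale_block_mx !scaler0 /pi scalerA scalerA divff ?gt_eqF// scale1r.
rewrite ulE alpha_ul.
congr block_mx; apply/matrixP => i j.
rewrite mul_tr_scaled_perm mul_scaled_perm !mxE !(inj_eq perm_inj) -mul_sc.
case: (eqVneq i k) => [->|_]; last by rewrite !mulr0.
case: (eqVneq j k) => [->|_]; last by rewrite !mulr0.
by rewrite /= !mulr1.
Qed.

(** In the new coordinates [y_k = s_(t k) x_(t k)], which is why [pi_k]
    carries the factor [1 / s_(t k)]. *)
Lemma canonical_diffusion (x : 'cV[R]_(m + n)) :
  L *m diffusion a alpha x *m L^T =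
  block_mx (diag_mx (\row_k if 0 < c (t k) then (L *m x) (lshift n k) 0 else 0))
    0 0 (p + \sum_k (L *m x) (lshift n k) 0 *: pi k).
Proof.
have yE k : (L *m x) (lshift n k) 0 = s (t k) * x (lshift n (t k)) 0.
  have /matrixP/(_ k 0) := usubmx_block_shear (scaled_perm s t) D x.
  by rewrite mul_scaled_perm !mxE.
rewrite /diffusion mulmxDr mulmxDl canonical_a (reindex_inj (@perm_inj _ t)).
rewrite mulmx_sumr mulmx_suml.
under eq_bigr => k _.
  rewrite -scalemxAr -scalemxAl canonical_alpha scalerA [_ * s _]mulrC -(yE k).
  over.
rewrite sum_block_diag add_block_mx !addr0 add0r diag_mx_sum_delta.
congr block_mx; apply: eq_bigr => k _; rewrite scalerA [in RHS]mxE.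
by case: (0 < c (t k)); rewrite ?mulr1 ?mulr0.
Qed.

End CanonicalForm.

(** * Stability of the state space and of the drift conditions *)

Section DriftStability.
Variables (R : realType) (m n : nat) (s : 'I_m -> R) (t : 'S_m).
Variable D : 'M[R]_(n, m).
Hypothesis s_gt0 : forall i, 0 < s i.
Let L : 'M[R]_(m + n) := block_mx (scaled_perm s t) 0 D 1%:M.

Let s_neq0 i : s i != 0. Proof. by rewrite gt_eqF. Qed.

Lemma scaled_shear_unit : L \in unitmx.
Proof.
exact: (mulmx1_unit (block_shearV D (scaled_permV t s_neq0))).1.
Qed.

Lemma state_space_scaled_shear (x : 'cV[R]_(m + n)) :
  state_space R m n (L *m x) <-> state_space R m n x.
Proof.
have LxE k : (L *m x) (lshift n k) 0 = s (t k) * x (lshift n (t k)) 0.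
  have /matrixP/(_ k 0) := usubmx_block_shear (scaled_perm s t) D x.
  by rewrite mul_scaled_perm !mxE.
split=> [Lx i|xpos k]; last first.
  by rewrite LxE mulr_ge0 ?(ltW (s_gt0 _))//; exact: xpos.
by have := Lx ((t^-1)%g i); rewrite LxE permKV pmulr_rge0.
Qed.

Lemma scaled_shear_image :
  [set L *m x | x in state_space R m n] = state_space R m n.
Proof.
apply/seteqP; split=> [_ [x xpos <-]|y ypos].
  exact/state_space_scaled_shear.
exists (invmx L *m y); last by rewrite mulKVmx ?scaled_shear_unit.
by apply/state_space_scaled_shear; rewrite mulKVmx ?scaled_shear_unit.
Qed.

Lemma scaled_shear_drift b (B : 'M[R]_(m + n)) :
  admissible_drift b B -> admissible_drift (L *m b) (L *m B *m invmx L).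
Proof.
move=> [b_pos B_IJ B_II].
have [ulE urE] := block_shear_conj D (scaled_permV t s_neq0) B_IJ.
split=> //; first exact/state_space_scaled_shear.
move=> i j ij; rewrite ulE mul_tr_scaled_perm mul_scaled_perm.
rewrite !mulr_ge0 ?invr_ge0 ?(ltW (s_gt0 _))//.
by apply: B_II; rewrite (inj_eq perm_inj).
Qed.

End DriftStability.

Theorem lemma7p1 (R : realType) (m n : nat) (hd : (1 <= m + n)%N)
    (a : 'M[R]_(m + n)) (alpha : 'I_(m + n) -> 'M[R]_(m + n))
    (b : 'cV[R]_(m + n)) (beta : 'I_(m + n) -> 'cV[R]_(m + n))
    (hadm : admissible a alpha b beta) :
  exists Lambda : 'M[R]_(m + n),
    [/\ Lambda \in unitmx,
        [set Lambda *m x | x in state_space R m n] = state_space R m n,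
        exists (q : nat) (p : 'M[R]_n) (pi : 'I_m -> 'M[R]_n),
          [/\ (q <= m)%N,
              sym_psd p,
              forall i, sym_psd (pi i)
            & forall y : 'cV[R]_(m + n),
                Lambda *m diffusion a alpha (invmx Lambda *m y) *m Lambda^T =
                block_mx
                  (diag_mx (\row_(i < m)
                     if (i < q)%N then y (lshift n i) 0 else 0))
                  0
                  0
                  (p + \sum_(i < m) y (lshift n i) 0 *: pi i)]
      & admissible_drift (Lambda *m b)
          (Lambda *m drift_matrix beta *m invmx Lambda)].
Proof.
case: hadm => adm adm_drift.
have [t tP] := exists_perm_prefix
  [pred i | 0 < alpha (lshift n i) (lshift n i) (lshift n i)].
have [s s_gt0 [D LE]] := canonical_mx_shape alpha t.
have Lu := scaled_shear_unit t D s_gt0.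
exists (canonical_mx alpha t); split.
- by rewrite LE.
- by rewrite LE; exact: scaled_shear_image.
- exists #|[pred i | 0 < alpha (lshift n i) (lshift n i) (lshift n i)]|.
  (* p and pi are read off the formula for the transformed diffusion *)
  do 2!eexists; split; last first.
  + move=> y; rewrite (canonical_diffusion adm t) mulKVmx ?LE//.
    congr block_mx; congr diag_mx.
    by apply/rowP => k; rewrite !mxE -tP.
  + move=> k; apply: sym_psdZ; last first.
      exact: sym_psd_drsub (sym_psd_congr _ (adm_alpha_psd adm _)).
    by rewrite invr_ge0; case: ifP => // /ltW; rewrite invr_ge0.
  + exact: sym_psd_drsub (sym_psd_congr _ (adm_a_psd adm)).
  + by rewrite -[m in (_ <= m)%N]card_ord max_card.
- by rewrite LE; exact: scaled_shear_drift.
Qed.
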